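(* Fix $\varepsilon>0$ and $\gamma\in(0,1)$, and let $d_N=(1-\gamma)\sqrt{\frac{\log N}{2\log\log N}}$. For a group $G$ of order $N$, an integer $d$ with $2\leqslant d\leqslant d_N$, and $p\geqslant \sqrt[d]{d!(1+\varepsilon)\frac{\log N}{N^{d-1}}}$, let $\Gamma\in\mathcal{G}(G,p)$. Then with high probability the diameter of $\Gamma$ is at most $d$; that is, $\Pr(\operatorname{diam}(\Gamma)>d)\to 0$ as $N\to\infty$, uniformly over all groups $G$ of order $N$, all such $d$ and all such $p$.
   Context: For a group $G$ and a subset $S\subseteq G$, the (undirected) Cayley graph $\Gamma(G;S)$ has vertex set $G$ and an edge between $g\neq h$ iff $g^{-1}h\in S$ or $h^{-1}g\in S$ (loops and multiple edges ignored). The model $\mathcal{G}(G,p)$ is the probability space of Cayley graphs $\Gamma(G;S)$ where each element of $G$ is put in $S$ independently with probability $p$. The diameter of a disconnected graph is infinite. ''With high probability'' means the error probability tends to $0$ as $N\to\infty$, uniformly over the class of groups under consideration. *)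

(* Defs.v *)
From HB Require Import structures.
From mathcomp Require Import all_boot all_order all_algebra all_fingroup.
From mathcomp Require Import boolp reals exp.
Set Implicit Arguments. Unset Strict Implicit. Unset Printing Implicit Defensive.
Import Order.TTheory GRing.Theory Num.Theory.

Definition cay_adj (gT : finGroupType) (S : {set gT}) : rel gT :=
  fun g h => (g != h) && (((g^-1 * h)%g \in S) || ((h^-1 * g)%g \in S)).

Definition dist_le (gT : finGroupType) (S : {set gT}) (k : nat) (g h : gT) : Prop :=
  exists s : seq gT, (size s <= k)%N /\ path (cay_adj S) g s /\ last g s = h.

(* diam(Gamma(G;S)) <= k  (a disconnected graph has infinite diameter). *)
Definition diam_le (gT : finGroupType) (S : {set gT}) (k : nat) : Prop :=
  forall g h : gT, dist_le S k g h.

Local Open Scope ring_scope.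

(* Pr_{S ~ G(G,p)} (E S): each element is in S independently with prob. p. *)
Definition cay_prob (R : realType) (gT : finGroupType) (p : R)
  (E : {set gT} -> Prop) : R :=
  \sum_(S : {set gT} | `[< E S >]) p ^+ #|S| * (1 - p) ^+ (#|gT| - #|S|)%N.

Definition dN (R : realType) (gam : R) (N : nat) : R :=
  (1 - gam) * Num.sqrt (ln (N%:R) / (2 * ln (ln (N%:R)))).

Definition p_threshold (R : realType) (eps : R) (N d : nat) : R :=
  powR ((d`!)%:R * (1 + eps) * ln (N%:R) / (N%:R) ^+ (d.-1)) (d%:R)^-1.

(* Main.v *)
Require Import Defs.
From HB Require Import structures.
From mathcomp Require Import all_boot all_order all_algebra all_fingroup.
From mathcomp Require Import boolp reals exp.
From mathcomp Require Import sequences ring lra.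
Import Order.TTheory GRing.Theory Num.Theory.
Local Open Scope ring_scope.

(** By a coupling we may take [p] equal to the threshold.  Fix [x != 1] and
    consider the words [t_1 ... t_(d-1) t_d^-1 = x] with distinct letters; the
    sets of letters form a family [F] of [d]-subsets of [G] with
    [#|F| * d! >= N^(d-1) - d^2 N^(d-2)].  If [S] contains a member of [F] then
    every [g] is joined to [g x] by a path of length at most [d].  In a word,
    any letter is determined by the others, so two overlapping members of [F]
    occur together so rarely that Janson's inequality bounds the probability
    that [S] contains no member of [F] by [N ^ -(1 + eps/2)]; a union bound
    over [x] concludes.  The instances of Harris' inequality behind Janson's
    are immediate here: conditioning on [U \subset S] amounts to replacing
    [S] by [U :|: S]. *)

(** * Expectation over a random subset, coupling and Janson's inequality *)

Lemma ler_bool (R : numDomainType) (a b : bool) : (a -> b) -> a%:R <= b%:R :> R.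
Proof. by case: a b => [] [] // /(_ isT). Qed.

Section BernoulliSubset.
Variables (R : realType) (T : finType).
Implicit Types (p q : R) (S U A B : {set T}) (g h : {set T} -> R).

Definition bernW p S : R := p ^+ #|S| * (1 - p) ^+ (#|T| - #|S|).

Definition bernE p g : R := \sum_S bernW p S * g S.

Lemma bernW_ge0 p S : 0 <= p -> p <= 1 -> 0 <= bernW p S.
Proof. by move=> p0 p1; rewrite mulr_ge0 ?exprn_ge0 // subr_ge0. Qed.

Lemma bernW_prod p S : bernW p S = \prod_x (if x \in S then p else 1 - p).
Proof.
rewrite (bigID (mem S)) /=.
rewrite (eq_bigr (fun=> p)); last by move=> x ->.
rewrite [X in _ * X](eq_bigr (fun=> 1 - p)); last by move=> x /negbTE ->.
rewrite !prodr_const /bernW -(cardC (mem S)).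
by rewrite addKn.
Qed.

Lemma bernE_le p g h : 0 <= p -> p <= 1 ->
  (forall S, g S <= h S) -> bernE p g <= bernE p h.
Proof. by move=> p0 p1 gh; apply: ler_sum => S _; rewrite ler_wpM2l ?bernW_ge0. Qed.

Lemma bernE_ge0 p g : 0 <= p -> p <= 1 -> (forall S, 0 <= g S) -> 0 <= bernE p g.
Proof. by move=> p0 p1 gh; apply: sumr_ge0 => S _; rewrite mulr_ge0 ?bernW_ge0. Qed.

Lemma eq_bernE p g h : g =1 h -> bernE p g = bernE p h.
Proof. by move=> gh; apply: eq_bigr => S _; rewrite gh. Qed.

Lemma bernEB p g h : bernE p (fun S => g S - h S) = bernE p g - bernE p h.
Proof.
by rewrite /bernE -sumrB; apply: eq_bigr => S _; rewrite mulrBr.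
Qed.

Lemma bernE_sum p (I : Type) (r : seq I) (P : pred I) (G : I -> {set T} -> R) :
  bernE p (fun S => \sum_(i <- r | P i) G i S) = \sum_(i <- r | P i) bernE p (G i).
Proof.
rewrite /bernE exchange_big /=; apply: eq_bigr => S _.
by rewrite mulr_sumr.
Qed.

Lemma bernE_indic p (P : pred {set T}) :
  \sum_(S : {set T} | P S) bernW p S = bernE p (fun S => (P S)%:R).
Proof. by rewrite big_mkcond; apply: eq_bigr => S _; case: (P S); rewrite ?mulr1 ?mulr0. Qed.

Lemma bernE_one p : bernE p (fun=> 1) = 1.
Proof.
rewrite /bernE (eq_bigr (fun S => \prod_x (if x \in S then p else 1 - p))); last first.
  by move=> S _; rewrite mulr1 bernW_prod.
by rewrite -bigA_distr big1 // => x _ /=; rewrite addrC subrK.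
Qed.

(** Pairing [S] with [S :\ x], whose weights are in ratio [p] to [1 - p], gives [p * (bernW p S +
    bernW p (S :\ x)) = bernW p S] for [x \in S]. *)
Lemma bernE_in p x g :
  bernE p (fun S => (x \in S)%:R * g S) = p * bernE p (fun S => g (x |: S)).
Proof.
have W1 S : x \notin S -> (1 - p) * bernW p (x |: S) = p * bernW p S.
  move=> xS; rewrite !bernW_prod (bigD1 x) //= [in RHS](bigD1 x) //= setU11 (negbTE xS).
  rewrite mulrCA; congr (_ * (_ * _)); apply: eq_bigr => y yx.
  by rewrite in_setU1 (negbTE yx).
rewrite /bernE (bigID (fun S => x \in S)) /= addrC big1 ?add0r; last first.
  by move=> S /negbTE ->; rewrite mul0r mulr0.
rewrite [in RHS](bigID (fun S => x \in S)) /= [X in p * (_ + X)](_ : _ =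
   \sum_(S : {set T} | x \in S) bernW p (S :\ x) * g S); last first.
  rewrite (reindex_onto (fun S => S :\ x) (fun S => x |: S)) /=; last first.
    by move=> S xS; rewrite setU1K.
  apply: eq_big => [S|S].
    rewrite setD11 /=; apply/eqP/idP => [<-|]; first by rewrite setU11.
    exact: setD1K.
  by move=> /andP[_ /eqP ->].
rewrite -big_split /= mulr_sumr; apply: eq_bigr => S xS.
have -> : x |: S = S by apply/setUidPr; rewrite sub1set.
have := W1 (S :\ x); rewrite setD11 => /(_ isT); rewrite setD1K // => h.
by rewrite xS mul1r mulrDr mulrA [p * (_ * g S)]mulrA -h; ring.
Qed.

Lemma bernE_sub p U g :
  bernE p (fun S => (U \subset S)%:R * g S) = p ^+ #|U| * bernE p (fun S => g (U :|: S)).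
Proof.
have [m] := ubnP #|U|; elim: m U g => // m IH U g; rewrite ltnS => Um.
have [->|[x xU]] := set_0Vmem U.
  by rewrite cards0 expr0 mul1r; apply: eq_bernE => S; rewrite sub0set mul1r set0U.
have cU : #|U| = #|U :\ x|.+1 by rewrite (cardsD1 x) xU.
rewrite (@eq_bernE _ _ (fun S => (x \in S)%:R * (((U :\ x) \subset S)%:R * g S))); last first.
  move=> S; rewrite mulrA -natrM mulnb; congr (_%:R * _).
  by rewrite -{1}(setD1K xU) subUset sub1set.
rewrite bernE_in (@eq_bernE _ _ (fun S => ((U :\ x) \subset S)%:R * g (x |: S))); last first.
  move=> S; congr (_%:R * _); congr (nat_of_bool _).
  by rewrite !subDset setUA setUid.
rewrite IH -?cU // cU exprS mulrA; congr (_ * _); apply: eq_bernE => S; congr g.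
by rewrite setUA setD1K.
Qed.

(* Coupling: sum over pairs [A \subset S] with [A ~ q], [S ~ p]. *)
Lemma bernE_anti p q g : 0 <= q -> q <= p -> p <= 1 ->
  (forall A B, A \subset B -> g B <= g A) -> bernE p g <= bernE q g.
Proof.
move=> q0 qp p1 gdec.
(* Each [x] independently lies in both sets with weight [q], in [S] alone with [p - q], in neither
   with [1 - p], and in [A] alone with weight 0. *)
pose m A S : R := \prod_x (if x \in A then (if x \in S then q else 0)
                         else (if x \in S then p - q else 1 - p)).
have mp S : bernW p S = \sum_A m A S.
  rewrite bernW_prod -(@bigA_distr _ _ _ _ _ _ (fun x => if x \in S then q else 0)
     (fun x => if x \in S then p - q else 1 - p)).
  by apply: eq_bigr => x _ /=; case: ifP => _; ring.
have mq A : bernW q A = \sum_S m A S.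
  rewrite bernW_prod (eq_bigr (fun S : {set T} => \prod_x
      (if x \in S then (if x \in A then q else p - q)
      else (if x \in A then 0 else 1 - p)))); last first.
    by move=> S _; apply: eq_bigr => x _; do 2!case: ifP.
  rewrite -bigA_distr.
  by apply: eq_bigr => x _ /=; case: ifP => _; ring.
rewrite /bernE; under eq_bigr do rewrite mp mulr_suml.
under [leRHS]eq_bigr do rewrite mq mulr_suml.
rewrite exchange_big /=; apply: ler_sum => A _; apply: ler_sum => S _.
have [AS|/subsetPn[x xA xS]] := boolP (A \subset S); last first.
  by rewrite /m (bigD1 x) //= xA (negbTE xS) !mul0r.
rewrite ler_wpM2l ?gdec // prodr_ge0 // => x _.
by do !case: ifP => _ //; rewrite subr_ge0.
Qed.

(** A list, because the members of the family are revealed one at a time. *)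
Definition avoids (s : seq {set T}) S := all (fun A => ~~ (A \subset S)) s.

Lemma avoids_anti s A B : A \subset B -> avoids s B -> avoids s A.
Proof.
move=> AB; apply: sub_all => C; apply: contra => CA; exact: subset_trans CA AB.
Qed.

(** The event [A \subset S] is independent of avoiding the members disjoint from [A], and each
    member [B] meeting [A] costs at most a factor [p ^+ #|A :|: B|] by Harris. *)
Lemma avoids_cons_le p A (s : seq {set T}) : 0 <= p -> p <= 1 ->
  bernE p (fun S => (avoids (A :: s) S)%:R) <=
  bernE p (fun S => (avoids s S)%:R) *
    (1 - (p ^+ #|A| - \sum_(B <- s | ~~ [disjoint A & B]) p ^+ #|A :|: B|)).
Proof.
move=> p0 p1; set c := p ^+ #|A| - _.
pose g S : R := (avoids [seq B : {set T} <- s | [disjoint A & B]] S)%:R.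
have E1 : bernE p (fun S => (avoids (A :: s) S)%:R) = bernE p (fun S => (avoids s S)%:R)
    - bernE p (fun S => (A \subset S)%:R * (avoids s S)%:R).
  rewrite -bernEB; apply: eq_bernE => S /=.
  by case: (A \subset S); case: (avoids s S); rewrite ?mul0r ?mul1r ?subr0 ?subrr.
rewrite E1 mulrBr mulr1 lerD2l lerN2.
have ge0 : 0 <= bernE p (fun S => (A \subset S)%:R * (avoids s S)%:R).
  by apply: bernE_ge0 => // S; rewrite mulr_ge0.
have av0 : 0 <= bernE p (fun S => (avoids s S)%:R) by apply: bernE_ge0.
(* A nonpositive [c] makes the claim trivial; a positive one permits enlarging the avoidance of [s]
   to the event [g]. *)
have [c0|c0] := leP c 0; first exact: le_trans (mulr_ge0_le0 av0 c0) ge0.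
have Eg : bernE p (fun S => (avoids s S)%:R) <= bernE p g.
  apply: bernE_le => // S; apply: ler_bool; rewrite /avoids all_filter.
  by apply: sub_all => B h /=; apply/implyP.
apply: le_trans (ler_wpM2r (ltW c0) Eg) _.
have -> : bernE p g * c = bernE p (fun S => (A \subset S)%:R * g S) -
    \sum_(B <- s | ~~ [disjoint A & B]) p ^+ #|A :|: B| * bernE p g.
  rewrite bernE_sub -mulr_suml mulrC mulrBl; congr (_ * _ - _).
  apply: eq_bernE => S; rewrite /g /avoids; congr (nat_of_bool _)%:R.
  apply: eq_in_all => B; rewrite mem_filter => /andP[dAB _]; congr (~~ _).
  apply/idP/idP => [BS|]; first exact: subset_trans BS (subsetUr _ _).
  move=> /subsetP BS; apply/subsetP => x xB; have := BS x xB; rewrite inE => /orP[xA|//].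
  by move: dAB; rewrite disjoint_sym => /disjointFr/(_ xB); rewrite xA.
(* Harris: forcing [A :|: B] into [S] can only lower [g]. *)
apply: (@le_trans _ _ (bernE p (fun S => (A \subset S)%:R * g S) -
    \sum_(B <- s | ~~ [disjoint A & B]) bernE p (fun S => ((A :|: B) \subset S)%:R * g S))).
  rewrite lerD2l lerN2; apply: ler_sum => B _; rewrite bernE_sub ler_wpM2l ?exprn_ge0 //.
  apply: bernE_le => // S; apply: ler_bool.
  by apply: avoids_anti; exact: subsetUr.
(* Pointwise: if [S] contains [A], satisfies [g] and yet contains some [B] of [s], then [B] meets
   [A], and its term in the sum makes up for the 1. *)
rewrite -bernE_sum -bernEB; apply: bernE_le => // S.
have [AS|nAS] := boolP (A \subset S); last first.
  rewrite !mul0r big1 ?subr0 // => B _.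
  by rewrite subUset (negbTE nAS) mul0r.
rewrite !mul1r.
have [gS|ngS] := boolP (avoids [seq B : {set T} <- s | [disjoint A & B]] S); last first.
  rewrite /g (negbTE ngS) sub0r (le_trans _ (ler0n _ _)) // oppr_le0.
  by apply: sumr_ge0 => B _; rewrite mulr0.
rewrite /g gS.
have sum0 (r : seq {set T}) : 0 <= \sum_(B <- r | ~~ [disjoint A & B])
    (A :|: B \subset S)%:R * 1 :> R by apply: sumr_ge0 => B _; rewrite mulr_ge0.
have [|/allPn[B Bs]] := boolP (avoids s S); first by rewrite lerBlDr lerDl.
rewrite negbK => BS.
rewrite subr_le0 (big_rem B) //=.
have -> : ~~ [disjoint A & B].
  apply/negP => dAB; move/allP: gS => /(_ B); rewrite mem_filter dAB Bs BS => /(_ isT) //.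
by rewrite subUset AS BS mulr1 lerDl.
Qed.

(* Janson's inequality, by the Boppana-Spencer argument *)
Lemma janson p (F : {set {set T}}) : 0 <= p -> p <= 1 ->
  bernE p (fun S => [forall A in F, ~~ (A \subset S)]%:R) <=
  expR (- \sum_(A in F) (p ^+ #|A| -
     \sum_(B in F | (B != A) && ~~ [disjoint A & B]) p ^+ #|A :|: B|)).
Proof.
move=> p0 p1; pose c (A : {set T}) : R := p ^+ #|A| -
     \sum_(B in F | (B != A) && ~~ [disjoint A & B]) p ^+ #|A :|: B|.
rewrite -[X in expR (- X)]/(\sum_(A in F) c A).
have main s : uniq s -> {subset s <= F} ->
   bernE p (fun S => (avoids s S)%:R) <= expR (- \sum_(A <- s) c A).
  elim: s => [_ _|A s IH /= /andP[As us] sF].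
    by rewrite big_nil oppr0 expR0 /= bernE_one.
  apply: le_trans (avoids_cons_le _ _ _ p0 p1) _.
  rewrite big_cons [in leRHS]opprD [in leRHS]addrC expRD.
  have av0 : 0 <= bernE p (fun S => (avoids s S)%:R) by apply: bernE_ge0.
  apply: (@le_trans _ _ (bernE p (fun S => (avoids s S)%:R) * expR (- c A))).
    (* The correction over all of [F] is at least the one over the tail [s], and
       [1 - c A <= expR (- c A)]. *)
    rewrite ler_wpM2l // (le_trans _ (expR_ge1Dx _)) // lerD2l lerN2 lerD2l lerN2.
    rewrite [leRHS](bigID (fun B => B \in s)) /= -[leLHS]addr0.
    rewrite lerD //; last by apply: sumr_ge0 => B _; exact: exprn_ge0.
    rewrite -big_filter -[leRHS]big_filter.
    rewrite le_eqVlt; apply/orP; left; apply/eqP.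
    apply: perm_big; apply: uniq_perm; rewrite ?filter_uniq ?index_enum_uniq //.
    move=> B; rewrite !mem_filter mem_index_enum andbT.
    have [Bs|] := boolP (B \in s); last by rewrite !andbF.
    rewrite !andbT [B \in F]sF ?inE ?Bs ?orbT //=.
    by case: eqP => [BA|//]; move: As; rewrite -BA Bs.
  rewrite ler_wpM2r ?expR_ge0 // IH // => B Bs; by rewrite sF // inE Bs orbT.
have := main (enum F) (enum_uniq _); rewrite big_enum => H.
apply: le_trans (H _); last by move=> A; rewrite mem_enum.
rewrite le_eqVlt; apply/orP; left; apply/eqP; apply: eq_bernE => S; congr (nat_of_bool _)%:R.
apply/forallP/allP => h A; first by rewrite mem_enum => AF; have := h A; rewrite AF.
by apply/implyP => AF; apply: h; rewrite mem_enum.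
Qed.

End BernoulliSubset.

Arguments bernW {R T}.
Arguments bernE {R T}.

(** * Families of words in which each letter is determined by the others *)

Lemma card_family_prod (I T : finType) (F : I -> {set T}) :
  #|family F| = (\prod_i #|F i|)%N.
Proof. by rewrite card_family foldrE big_map big_enum. Qed.

Section Latin.
Variables (T : finType) (d : nat).
Implicit Types (A B : {set T}) (D : {set {ffun 'I_d -> T}}) (t u : {ffun 'I_d -> T}).

(** A partial Latin hypercube. *)
Definition latin D :=
  forall k t u, t \in D -> u \in D -> (forall i, i != k -> t i = u i) -> t = u.

Definition img t : {set T} := t @: setT.

(** Forgetting the [k]-th letter is injective on [D], so only the other letters are counted. *)
Lemma latin_card D k (C : 'I_d -> {set T}) : latin D ->
  (#|[set t in D | [forall i, (i != k) ==> (t i \in C i)]]| <=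
   \prod_(i | i != k) #|C i|)%N.
Proof.
move=> latD; set E := [set t in D | _].
have [->|[t0 _]] := set_0Vmem E; first by rewrite cards0.
pose phi t := [ffun i => if i == k then t0 k else t i].
have inj : {in E &, injective phi}.
  move=> t u; rewrite !inE => /andP[tD _] /andP[uD _] /ffunP e.
  apply: (latD k) => // i ik; have := e i; by rewrite !ffunE (negbTE ik).
rewrite -(card_in_imset inj).
pose F i := if i == k then [set t0 k] else C i.
have -> : (\prod_(i | i != k) #|C i| = #|family F|)%N.
  rewrite card_family_prod [in RHS](bigD1 k) //= {1}/F eqxx cards1 mul1n.
  by apply: eq_bigr => i ik; rewrite /F (negbTE ik).
apply: subset_leq_card; apply/subsetP => _ /imsetP[t tE ->].
apply/familyP => i; rewrite ffunE /F; case: eqP => [_|/eqP ik]; first by rewrite inE.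
by move: tE; rewrite inE => /andP[_ /forallP/(_ i)/implyP]; exact.
Qed.

Lemma card_img t : injective t -> #|img t| = d.
Proof. by move=> it; rewrite card_imset // cardsT card_ord. Qed.

(** A set of [d] letters is spelled by at most d! injective words. *)
Lemma card_img_fibers D : (forall t, t \in D -> injective t) ->
  (#|D| <= d`! * #|img @: D|)%N.
Proof.
move=> injD; rewrite -sum1_card (partition_big_imset img) /= mulnC -sum_nat_const.
apply: leq_sum => A /imsetP[t0 t0D ->]; rewrite sum1_card.
have := card_inj_ffuns_on 'I_d (mem (img t0)).
rewrite card_img ?card_ord ?ffactnn; last exact: injD.
move=> <-; apply: subset_leq_card; apply/subsetP => t.
rewrite unfold_in inE => /andP[tD /eqP e]; apply/andP; split.
  by apply/ffun_onP => i; rewrite -e; apply/imsetP; exists i.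
by apply/injectiveP; exact: injD.
Qed.

Lemma card_imgU A t : injective t -> #|A| = d ->
  #|A :|: img t| = (d + #|~: [set i | t i \in A]|)%N.
Proof.
move=> it cA; have -> : A :|: img t = A :|: (img t :\: A).
  by apply/setP => x; rewrite !inE; case: (x \in A).
have -> : img t :\: A = t @: (~: [set i | t i \in A]).
  apply/setP => x; rewrite !inE; apply/andP/imsetP.
    by move=> [xA /imsetP[i _ e]]; exists i => //; rewrite !inE -e.
  by move=> [i]; rewrite !inE => iA ->; split => //; apply: imset_f.
rewrite cardsU card_imset // cA (_ : _ :&: _ = set0) ?cards0 ?subn0 //.
apply/setP => x; rewrite !inE; apply/negP => /andP[xA /imsetP[i]].
by rewrite !inE => /negP iA e; apply: iA; rewrite -e.
Qed.

(* Sum over the proper nonempty set [J] of positions whose letter lies in [A]. *)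
Lemma latin_overlap (R : realType) (p : R) D A : 0 <= p ->
  latin D -> (forall t, t \in D -> injective t) -> #|A| = d ->
  #|T|%:R * (\sum_(B in img @: D | (B != A) && ~~ [disjoint A & B]) p ^+ #|A :|: B|)
  <= p ^+ d * ((#|T|%:R * p + d%:R) ^+ d - (#|T|%:R * p) ^+ d).
Proof.
move=> p0 latD injD cA; set N := #|T|%:R; set y := N * p.
have N0 : 0 <= N by rewrite /N.
have y0 : 0 <= y by rewrite mulr_ge0.
pose I t := [set i | t i \in A].
pose Q J := (J != set0 :> {set 'I_d}) && (J != setT).
(* Each [B] is charged to one word spelling it; since [B] meets [A] and differs from it, the
   positions [I t] form a proper nonempty set. *)
have step1 : \sum_(B in img @: D | (B != A) && ~~ [disjoint A & B]) p ^+ #|A :|: B|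
   <= \sum_(t in D | Q (I t)) p ^+ (d + #|~: I t|).
  rewrite big_mkcondr [leRHS]big_mkcondr /= [leRHS](partition_big_imset img) /=.
  apply: ler_sum => B /imsetP[t tD ->].
  rewrite (bigD1 t) /=; last by rewrite tD eqxx.
  case: ifP => [/andP[BA dis]|_]; last first.
    by rewrite addr_ge0 ?sumr_ge0 // => *; case: ifP => // _; rewrite exprn_ge0.
  rewrite ifT; last first.
    apply/andP; split.
      apply: contra dis => /eqP I0; rewrite disjoint_sym disjoint_subset.
      apply/subsetP => _ /imsetP[i _ ->]; have : i \notin I t by rewrite I0 inE.
      by rewrite !inE.
    apply: contra BA => /eqP IT; rewrite eqEcard cA card_img ?leqnn ?andbT; last exact: injD.
    apply/subsetP => _ /imsetP[i _ ->]; have : i \in I t by rewrite IT inE.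
    by rewrite !inE.
  rewrite (card_imgU _ _ (injD _ tD) cA) lerDl sumr_ge0 // => *.
  by case: ifP => // _; rewrite exprn_ge0.
apply: le_trans (ler_wpM2l N0 step1) _.
have -> : \sum_(t in D | Q (I t)) p ^+ (d + #|~: I t|) =
    p ^+ d * \sum_(J | Q J) p ^+ #|~: J| * (#|[set t in D | I t == J]|)%:R.
  rewrite (partition_big I Q) /=; last by move=> t /andP[].
  rewrite mulr_sumr; apply: eq_bigr => J QJ.
  rewrite (eq_bigr (fun=> p ^+ d * p ^+ #|~: J|)); last first.
    by move=> t /andP[_ /eqP ->]; rewrite exprD.
  rewrite sumr_const -[LHS]mulr_natr [RHS]mulrA; congr (_ * _%:R).
  apply: eq_card => t; rewrite !inE unfold_in /=.
  by case: eqP => [->|//]; rewrite ?QJ ?andbT ?andbF.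
rewrite mulrCA ler_wpM2l ?exprn_ge0 // mulr_sumr.
(* Binomial expansion over subsets: subtracting [y ^+ d] removes [J = set0], and the nonnegative
   term [J = setT] is dropped. *)
have -> : (y + d%:R) ^+ d = \sum_(J : {set 'I_d}) y ^+ #|~: J| * d%:R ^+ #|J|.
  rewrite -[d in _ ^+ d]card_ord -prodr_const addrC bigA_distr; apply: eq_bigr => J _.
  rewrite (bigID (mem J)) /= (eq_bigr (fun=> d%:R)); last by move=> i ->.
  rewrite prodr_const [X in _ * X](eq_bigr (fun=> y)); last by move=> i /negbTE ->.
  rewrite prodr_const mulrC; congr (_ ^+ _ * _); apply: eq_card => i; by rewrite !inE.
rewrite [leRHS](_ : _ = \sum_(J : {set 'I_d} | J != set0) y ^+ #|~: J| * d%:R ^+ #|J|); last first.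
  by rewrite (bigD1 set0) //= setC0 cardsT card_ord cards0 expr0 mulr1 addrAC subrr add0r.
rewrite [leRHS](bigID (fun J => J != setT)) /= -[leLHS]addr0 lerD //; last first.
  by apply: sumr_ge0 => J _; rewrite mulr_ge0 ?exprn_ge0.
apply: ler_sum => J /andP[J0 JT].
have [k kJ] : exists k, k \notin J.
  by move: JT; rewrite -subTset => /subsetPn[k _ kJ]; exists k.
(* There are [d] choices at each position of [J] and [#|T|] at the others, except at one position
   [k] outside [J], which the rest determines; this saves a factor [#|T|]. *)
have cJ : (#|[set t in D | I t == J]| <= d ^ #|J| * #|T| ^ #|~: J|.-1)%N.
  pose C i := if i \in J then A else setT.
  apply: leq_trans (leq_trans (latin_card D k C latD) _).
    apply: subset_leq_card; apply/subsetP => t; rewrite !inE => /andP[-> /eqP e] /=.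
    by apply/forallP => i; apply/implyP => _; rewrite /C -e !inE; case: ifP => //; rewrite inE.
  rewrite (bigID (mem J)) /= (eq_bigr (fun=> d)); last first.
    by move=> i /andP[_ iJ]; rewrite /C iJ.
  rewrite [X in (_ * X)%N](eq_bigr (fun=> #|T|)); last first.
    by move=> i /andP[_ /negbTE iJ]; rewrite /C iJ cardsT.
  rewrite !prod_nat_const leq_eqVlt; apply/orP; left; apply/eqP; congr (_ ^ _ * _ ^ _)%N.
    by apply: eq_card => i; rewrite unfold_in /=; case: eqP => [->|//]; rewrite (negbTE kJ).
  rewrite (cardsD1 k) !inE kJ /=; apply: eq_card => i; by rewrite !inE.
have cC : #|~: J| = #|~: J|.-1.+1 by rewrite prednK // (cardD1 k) !inE kJ.
rewrite mulrCA /y exprMn [N ^+ _ * _]mulrC -[leRHS]mulrA.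
rewrite ler_wpM2l ?exprn_ge0 // (@le_trans _ _ (N * (d ^ #|J| * #|T| ^ #|~: J|.-1)%:R)) //.
  by rewrite ler_wpM2l // ler_nat.
by rewrite natrM !natrX mulrCA -exprS -cC mulrC.
Qed.

(** Janson's inequality, with the overlaps costing each member at most the fraction [eta] of
    [p ^+ d]. *)
Lemma latin_avoid (R : realType) (p eta : R) D : (0 < d)%N -> 0 <= p -> p <= 1 ->
  latin D -> (forall t, t \in D -> injective t) ->
  (#|T|%:R * p + d%:R) ^+ d - (#|T|%:R * p) ^+ d <= #|T|%:R * eta ->
  bernE p (fun S => [forall A in img @: D, ~~ (A \subset S)]%:R) <=
    expR (- (#|img @: D|%:R * p ^+ d * (1 - eta))).
Proof.
move=> d0 p0 p1 latD injD Heta; apply: le_trans (janson _ _ _ _ p0 p1) _.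
rewrite ler_expR lerN2 -mulrA mulr_natl -sumr_const; apply: ler_sum => A /imsetP[t tD ->].
have cA := card_img _ (injD _ tD).
rewrite cA mulrBr mulr1 lerD2l lerN2.
have N0 : 0 < #|T|%:R :> R.
  by rewrite ltr0n; apply/card_gt0P; exists (t (Ordinal d0)).
rewrite -(ler_pM2l N0); apply: le_trans (latin_overlap _ _ _ _ p0 latD injD cA) _.
by rewrite mulrCA ler_wpM2l ?exprn_ge0.
Qed.

End Latin.

Arguments latin {T d}.
Arguments img {T d}.

(** * Counting the words that evaluate to a given group element *)

Section Words.
Variable gT : finGroupType.
Local Open Scope group_scope.

(** Peel off the last factor: it cancels on the right or, when it is the one at [k], the common
    prefix cancels on the left. *)
Lemma prod_ord_cancel (m : nat) (f g : 'I_m -> gT) (k : 'I_m) :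
  (forall i, i != k -> f i = g i) ->
  \prod_(i < m) f i = \prod_(i < m) g i -> f k = g k.
Proof.
elim: m f g k => [|m IH] f g k; first by case: k.
move=> e; rewrite !big_ord_recr /=.
have [kmax|kmax] := eqVneq k ord_max.
  rewrite kmax (eq_bigr (fun i => g (widen_ord (leqnSn m) i))); first by move/mulgI.
  by move=> i _; apply: e; rewrite kmax -val_eqE /= neq_ltn ltn_ord.
rewrite (e ord_max) 1?eq_sym // => /mulIg E.
have km : (k < m)%N.
  by have := ltn_ord k; rewrite ltnS leq_eqVlt => /orP[/eqP h|//]; case/eqP: kmax; apply: val_inj.
have -> : k = widen_ord (leqnSn m) (Ordinal km) by apply: val_inj.
apply: (IH (fun i => f (widen_ord (leqnSn m) i)) (fun i => g (widen_ord (leqnSn m) i))) => //.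
by move=> i ik; apply: e; rewrite -val_eqE.
Qed.

Variable n : nat.
Implicit Types (x : gT) (t u : {ffun 'I_n.+2 -> gT}).

(* The inverse on the last letter makes [t i = t j] impossible for words of
   length 2 evaluating to [x != 1]; with plain products, [x] might have too
   many square roots. *)
Definition word t := (\prod_(i < n.+1) t (widen_ord (leqnSn _) i)) * (t ord_max)^-1.

Definition sol x := [set t | word t == x].

(** Distinct letters give every letter set exactly [d = n.+2] elements. *)
Definition good x := [set t in sol x | injectiveb t].

Lemma latin_sol x : latin (sol x).
Proof.
move=> k t u; rewrite !inE => /eqP tx /eqP ux e; apply/ffunP => i.
have [->|] := eqVneq i k; last exact: e.
have : word t = word u by rewrite tx.
rewrite /word; have [kmax|kmax] := eqVneq k ord_max.
  rewrite kmax (eq_bigr (fun i => u (widen_ord (leqnSn _) i))).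
    by move/mulgI/invg_inj.
  by move=> j _; apply: e; rewrite kmax -val_eqE /= neq_ltn ltn_ord.
rewrite (e ord_max) 1?eq_sym // => /mulIg E.
have km : (k < n.+1)%N.
  by have := ltn_ord k; rewrite ltnS leq_eqVlt => /orP[/eqP h|//]; case/eqP: kmax; apply: val_inj.
have -> : k = widen_ord (leqnSn n.+1) (Ordinal km) by apply: val_inj.
apply: (prod_ord_cancel _ (fun i => t (widen_ord (leqnSn _) i))
  (fun i => u (widen_ord (leqnSn _) i))) => //.
by move=> j jk; apply: e; rewrite -val_eqE.
Qed.

Lemma latin_good x : latin (good x).
Proof.
move=> k t u; rewrite !inE => /andP[tx _] /andP[ux _]; apply: (latin_sol x); by rewrite inE.
Qed.

Lemma good_inj x t : t \in good x -> injective t.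
Proof. by rewrite inE => /andP[_ /injectiveP]. Qed.

Lemma card_family_fixed (J : {set 'I_n.+2}) :
  #|family (fun l => if l \in J then [set 1] else [set: gT])| = (#|gT| ^ (n.+2 - #|J|))%N.
Proof.
rewrite card_family_prod (bigID (mem J)) /= big1 ?mul1n; last by move=> i ->; rewrite cards1.
rewrite (eq_bigr (fun=> #|gT|)); last by move=> i /negbTE ->; rewrite cardsT.
rewrite prod_nat_const; congr (_ ^ _)%N.
have e := etrans (cardC (mem J)) (card_ord _).
by apply: (@addnI #|J|); rewrite [LHS]e subnKC // -[X in (_ <= X)%N]e leq_addr.
Qed.

(** The first [n.+1] letters are free and the last is solved for; free choices are encoded as words
    with last letter 1. *)
Lemma card_sol x : (#|gT| ^ n.+1 <= #|sol x|)%N.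
Proof.
have := card_family_fixed [set ord_max]; rewrite cards1 subSS subn0 => <-.
set X := family _.
pose phi t : {ffun 'I_n.+2 -> gT} := [ffun i => if i == ord_max
   then x^-1 * \prod_(i < n.+1) t (widen_ord (leqnSn _) i) else t i].
have inj : {in X &, injective phi}.
  move=> t u /familyP tX /familyP uX /ffunP e; apply/ffunP => i.
  have := e i; rewrite !ffunE; case: eqP => // -> _.
  by have := tX ord_max; have := uX ord_max; rewrite !inE eqxx !inE => /eqP -> /eqP ->.
rewrite -(card_in_imset inj); apply: subset_leq_card; apply/subsetP => _ /imsetP[t _ ->].
rewrite inE /word ffunE eqxx (eq_bigr (fun i => t (widen_ord (leqnSn _) i))).
  by rewrite invMg invgK mulKVg.
by move=> i _; rewrite ffunE ifF //; apply/negbTE; rewrite -val_eqE /= neq_ltn ltn_ord.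
Qed.

(** With a third position [k], erasing the letters at [i] and [k] loses nothing: the former is
    copied from [j], and the latter is then determined. In length 2 the coincidence forces the value
    [a a^-1 = 1], excluded by [x != 1]. *)
Lemma card_sol_coincidence x i j : x != 1 -> i != j ->
  (#|[set t in sol x | t i == t j]| <= #|gT| ^ n)%N.
Proof.
move=> x1 ij; set X := [set t in _ | _].
have [/existsP[k /andP[ki kj]]|] := boolP [exists k, (k != i) && (k != j)].
  pose phi t : {ffun 'I_n.+2 -> gT} := [ffun l => if l \in [set i; k] then 1 else t l].
  have inj : {in X &, injective phi}.
    move=> t u; rewrite 2!inE => /andP[tx /eqP tij]; rewrite 2!inE => /andP[ux /eqP uij] /ffunP e.
    apply: (latin_sol x k) => //; rewrite ?inE // => l lk.
    have tu m : m != i -> m != k -> t m = u m.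
      by move=> mi mk; have := e m; rewrite !ffunE !inE (negbTE mi) (negbTE mk).
    have [->|li] := eqVneq l i; last exact: tu.
    by rewrite tij uij; apply: tu; rewrite eq_sym.
  rewrite -(card_in_imset inj).
  have := card_family_fixed [set i; k]; rewrite cards2 eq_sym ki !subSS subn0 => <-.
  apply: subset_leq_card; apply/subsetP => _ /imsetP[t _ ->].
  by apply/familyP => l; rewrite ffunE; case: ifP; rewrite inE.
rewrite negb_exists => /forallP H.
have n0 : n = 0%N.
  have : ([set: 'I_n.+2] \subset [set i; j]).
    apply/subsetP => k _; have := H k; by rewrite negb_and !negbK !inE.
  by move=> /subset_leq_card; rewrite cardsT card_ord cards2 ij; case: (n).
rewrite (_ : X = set0) ?cards0 //; apply/setP => t; rewrite !inE.
apply/negP => /andP[/eqP tx /eqP tij]; case/eqP: x1.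
have tc k : t k = t i.
  by have := H k; rewrite negb_and !negbK => /orP[] /eqP ->.
rewrite -tx /word (tc ord_max) (eq_bigr (fun=> t i)) //.
by rewrite big_const_ord; move: (t i) => a; rewrite n0 /= mulg1 mulgV.
Qed.

(** Union bound over the [n.+2 ^ 2] pairs of positions where letters may coincide. *)
Lemma card_good x : x != 1 -> (#|gT| ^ n.+1 <= #|good x| + n.+2 ^ 2 * #|gT| ^ n)%N.
Proof.
move=> x1; apply: leq_trans (card_sol x) _.
pose coll (ij : 'I_n.+2 * 'I_n.+2) := [set t in sol x | (ij.1 != ij.2) && (t ij.1 == t ij.2)].
have sub : sol x \subset good x :|: \bigcup_ij coll ij.
  apply/subsetP => t tx; rewrite inE [t \in good x]inE tx /=.
  have [//|/injectivePn[i [j ij e]]] := boolP (injectiveb t).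
  by apply/bigcupP; exists (i, j) => //; rewrite inE tx /= ij e eqxx.
apply: leq_trans (subset_leq_card sub) _; apply: leq_trans (leq_card_setU _ _) _.
rewrite leq_add2l; apply: (@leq_trans (\sum_ij #|coll ij|)).
  elim/big_rec2: _ => [|ij m X _ h]; first by rewrite cards0.
  by apply: leq_trans (leq_card_setU _ _) _; rewrite leq_add2l.
apply: (@leq_trans (\sum_(ij : 'I_n.+2 * 'I_n.+2) #|gT| ^ n)).
  apply: leq_sum => -[i j] _; rewrite /coll /=.
  have [->|ij] := eqVneq i j; last exact: card_sol_coincidence.
  by rewrite (_ : finset _ = set0) ?cards0 //; apply/setP => t; rewrite !inE andbF.
by rewrite sum_nat_const card_prod card_ord.
Qed.

End Words.

Arguments word {gT}.
Arguments good {gT}.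

(** * From words over [S] to paths in the Cayley graph *)

Section Distance.
Variables (gT : finGroupType) (S : {set gT}).
Local Open Scope group_scope.

Lemma dist_le_step k g h s : s \in S -> dist_le S k g h ->
  dist_le S k.+1 g (h * s) /\ dist_le S k.+1 g (h * s^-1).
Proof.
move=> sS [w [wk [pw lw]]].
(* [1] may lie in [S] but yields no edge; the old path is kept, as lengths are only bounded
   above. *)
have [->|s1] := eqVneq s 1.
  by rewrite invg1 mulg1; split; exists w; rewrite (leq_trans wk).
have step r : r != 1 -> (r \in S) || (r^-1 \in S) -> dist_le S k.+1 g (h * r).
  move=> r1 rS; exists (rcons w (h * r)); rewrite size_rcons last_rcons rcons_path pw lw /=.
  split=> //; split=> //; rewrite /cay_adj mulKg invMg mulgKV rS andbT.
  by rewrite -{1}[h]mulg1 (inj_eq (mulgI _)) eq_sym.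
by split; apply: step; rewrite ?invgK ?sS ?orbT // -eq_invg1 ?invgK.
Qed.

Lemma dist_le_prod m (f : 'I_m -> gT) g : (forall i, f i \in S) ->
  dist_le S m g (g * \prod_(i < m) f i).
Proof.
elim: m f => [|m IH] f fS; first by rewrite big_ord0 mulg1; exists [::].
rewrite big_ord_recr /= mulgA.
have H := IH (fun i => f (widen_ord (leqnSn m) i)) (fun i => fS _).
by have [] := dist_le_step _ _ _ _ (fS ord_max) H.
Qed.

Lemma dist_le_word n (t : {ffun 'I_n.+2 -> gT}) g : img t \subset S ->
  dist_le S n.+2 g (g * word n t).
Proof.
move=> /subsetP tS; have fS i : t i \in S by apply: tS; apply: imset_f.
rewrite /word mulgA.
have H := dist_le_prod n.+1 (fun i => t (widen_ord (leqnSn _) i)) g (fun i => fS _).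
by have [] := dist_le_step _ _ _ _ (fS ord_max) H.
Qed.

(** A path from [g] to [h] is spelled by a word for [x = g^-1 h]. *)
Lemma diam_le_words n :
  (forall x, x != 1 -> ~~ [forall A in img @: good n x, ~~ (A \subset S)]) ->
  diam_le S n.+2.
Proof.
move=> H g h; have [->|gh] := eqVneq g h; first by exists [::].
have x1 : g^-1 * h != 1 by rewrite -eq_mulVg1.
have := H _ x1; rewrite negb_forall => /existsP[A]; rewrite negb_imply negbK => /andP[].
move=> /imsetP[t tg ->] tS; have := dist_le_word _ _ g tS.
by move: tg; rewrite !inE => /andP[/eqP -> _]; rewrite mulKVg.
Qed.

End Distance.

(** * Union bound over group elements, and estimates at the threshold *)

Lemma cay_prob_union (R : realType) (gT : finGroupType) (n : nat) (p : R) :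
  0 <= p -> p <= 1 ->
  cay_prob p (fun S : {set gT} => ~ diam_le S n.+2) <=
  \sum_(x : gT | x != 1%g) bernE p
     (fun S => [forall A in img @: good n x, ~~ (A \subset S)]%:R).
Proof.
move=> p0 p1; rewrite /cay_prob -[leLHS]/(\sum_(S : {set gT} | `[< ~ diam_le S n.+2 >]) bernW p S).
rewrite (bernE_indic _ _ _ (fun S => `[< ~ diam_le S n.+2 >])) -bernE_sum.
apply: bernE_le => // S; case: asboolP => [nd|_]; last by apply: sumr_ge0.
have [/existsP[x /andP[x1 bad]]|H] := boolP [exists x : gT, (x != 1%g) &&
   [forall A in img @: good n x, ~~ (A \subset S)]].
  by rewrite (bigD1 x) //= bad lerDl; apply: sumr_ge0.
case: nd; apply: diam_le_words => x x1; move: H; rewrite negb_exists => /forallP/(_ x).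
by rewrite x1.
Qed.

(** With [u = d^2 / y <= 1/2], one has [(1 + d / y)^d <= expR u <= 1 / (1 - u) <= 1 + 2 u]. *)
Lemma exprD_sub_le (R : realType) (y : R) (d : nat) : 0 < y ->
  2 * d%:R ^+ 2 <= y -> (y + d%:R) ^+ d - y ^+ d <= y ^+ d * (2 * d%:R ^+ 2 / y).
Proof.
move=> y0 dy; set u := d%:R ^+ 2 / y; set z := (1 + d%:R / y) ^+ d.
have u0 : 0 <= u by rewrite divr_ge0 ?exprn_ge0 // ltW.
have u2 : 2 * u <= 1 by rewrite mulrA ler_pdivrMr // mul1r.
have zu : z <= expR u.
  rewrite (_ : u = d%:R * (d%:R / y)); last by rewrite /u expr2 mulrA.
  rewrite expRM_natl lerXn2r ?nnegrE ?expR_ge0 ?addr_ge0 ?divr_ge0 ?(ltW y0) //.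
  exact: expR_ge1Dx.
have z1u : z * (1 - u) <= 1.
  rewrite -[leRHS](expRxMexpNx_1 u) ler_pM ?expR_ge1Dx //; last by lra.
  by rewrite exprn_ge0 // addr_ge0 // divr_ge0 // ltW.
have z2 : z <= 1 + 2 * u.
  have h : 0 < 1 - u by lra.
  rewrite -(ler_pM2r h); apply: (le_trans z1u).
  have : 0 <= u * (1 - 2 * u) by rewrite mulr_ge0 //; lra.
  lra.
have -> : y + d%:R = y * (1 + d%:R / y) by field; rewrite gt_eqF.
rewrite exprMn -/z -[X in _ - X]mulr1 -mulrBr ler_wpM2l ?exprn_ge0 ?(ltW y0) //.
rewrite -mulrA -/u; lra.
Qed.

Lemma fact_le_exp n : (n.+1`! <= n.+1 ^ n)%N.
Proof.
elim: n => // n IH; rewrite factS expnS leq_mul2l /=; apply: (leq_trans IH).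
by case: n {IH} => // n; rewrite leq_exp2r.
Qed.

Lemma dN_le (R : realType) (gam : R) (N d : nat) : 0 < gam -> gam < 1 ->
  1 <= ln (ln N%:R : R) -> d%:R <= dN gam N -> 2 * ln (ln N%:R) * d%:R ^+ 2 <= (ln N%:R : R).
Proof.
rewrite /dN; set L := ln N%:R; set l := ln L => g0 g1 l1 dle.
(* [ln] vanishes at nonpositive arguments, so [1 <= ln L] rules out [L < 0]. *)
have L0 : 0 <= L by rewrite leNgt; apply/negP => h; move: l1; rewrite /l ln0 ?ler10 // ltW.
have Q0 : 0 <= L / (2 * l) by rewrite divr_ge0 //; lra.
have d1 : d%:R <= Num.sqrt (L / (2 * l)).
  apply: (le_trans dle); rewrite ler_piMl ?sqrtr_ge0 //; lra.
have : d%:R ^+ 2 <= L / (2 * l).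
  by rewrite -[leRHS]sqr_sqrtr // lerXn2r ?nnegrE ?sqrtr_ge0.
by rewrite ler_pdivlMr 1?mulrC //; lra.
Qed.

Lemma p_threshold_expn (R : realType) (eps : R) (N d : nat) : 0 < eps ->
  (0 < d)%N -> 0 <= (ln N%:R : R) ->
  p_threshold eps N d ^+ d = d`!%:R * (1 + eps) * ln N%:R / N%:R ^+ d.-1.
Proof.
move=> e0 d0 L0; rewrite /p_threshold; set X := _ / _.
have X0 : 0 <= X by rewrite divr_ge0 ?exprn_ge0 // !mulr_ge0 //; lra.
rewrite -powR_mulrn ?powR_ge0 // -powRrM mulVf ?powRr1 //.
by rewrite pnatr_eq0 -lt0n.
Qed.

(* [y = N p] at the threshold; it exceeds [N ^ (1/d) >= L ^ (2d)], which beats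
   the factor [d! d^2] coming from the dependent pairs. *)
Lemma threshold_dominates (R : realType) (eps y : R) (N n : nat) :
  0 < eps -> (0 < N)%N -> expR 1 <= ln N%:R :> R ->
  2 * ln (ln N%:R) * n.+2%:R ^+ 2 <= ln N%:R :> R -> 0 <= y ->
  y ^+ n.+2 = N%:R * (n.+2`!%:R * (1 + eps) * ln N%:R) ->
  2 * (n.+2`!%:R * (1 + eps) * ln N%:R) * n.+2%:R ^+ 2 <= 2 * (1 + eps) / ln N%:R * y.
Proof.
set L := ln N%:R => e0 N0 Le dL y0 yd.
have L1 : 1 <= L by apply: le_trans Le; have := expR_ge1Dx (1 : R); lra.
have L0 : 0 < L by lra.
have l1 : 1 <= ln L by rewrite -(expRK 1) ler_ln ?posrE ?expR_gt0.
have d2L : n.+2%:R ^+ 2 <= L.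
  apply: le_trans dL; rewrite ler_peMl ?exprn_ge0 //; lra.
have dL1 : n.+2%:R <= L.
  by apply: le_trans d2L; rewrite expr2 ler_peMl // ler1n.
have F1 : 1 <= n.+2`!%:R :> R by rewrite ler1n fact_gt0.
have M1 : 1 <= n.+2`!%:R * (1 + eps) * L.
  by rewrite !mulr_ege1 //; lra.
(* [y^d] is [N] times a factor at least 1, so [y] is at least the [d]-th root of [N]. *)
have Ny : expR (L / n.+2%:R) <= y.
  rewrite -(@ler_pXn2r _ n.+2 isT) ?nnegrE ?expR_ge0 // yd -expRM_natl mulrC divfK ?pnatr_eq0 //.
  by rewrite lnK ?posrE ?ltr0n // ler_peMr.
have Ly : L ^+ (2 * n.+2) <= y.
  apply: le_trans Ny; rewrite -{1}(lnK (x := L)) ?posrE // -expRM_natl ler_expR.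
  rewrite ler_pdivlMr ?ltr0n // natrM; apply: le_trans dL; rewrite le_eqVlt; apply/orP; left.
  by apply/eqP; ring.
have FL : n.+2`!%:R <= L ^+ n.+1.
  apply: (@le_trans _ _ (n.+2%:R ^+ n.+1)); last by rewrite lerXn2r ?nnegrE // ltW.
  by rewrite -natrX ler_nat fact_le_exp.
(* The target is [d! L d^2 <= L^(d-1) L L]; one more factor [L] fits because [d + 2 <= 2 d]. *)
have yL : L ^+ n.+3 <= y / L.
  rewrite ler_pdivlMr // -exprSr; apply: le_trans Ly; rewrite ler_weXn2l //.
  by rewrite mul2n -addnn !addSn !addnS !ltnS leq_addl.
apply: (@le_trans _ _ (2 * (1 + eps) * L ^+ n.+3)); last first.
  by rewrite [leRHS]mulrAC -[leRHS]mulrA ler_wpM2l //; lra.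
rewrite [leLHS](_ : _ = 2 * (1 + eps) * (n.+2`!%:R * L * n.+2%:R ^+ 2)); last by ring.
rewrite ler_wpM2l //; first by lra.
rewrite (exprSr L n.+2) (exprSr L n.+1) ler_pM ?mulr_ge0 ?exprn_ge0 //; [exact: ltW|].
by rewrite ler_wpM2r // ltW.
Qed.

(** [K] is the main term of the expected number of members inside [S]. Two factors [1 - eta] are
    lost: one to overlapping pairs, one to words with repeated letters. *)
Lemma bernE_good_le (R : realType) (gT : finGroupType) (n : nat) (x : gT) (q K eta : R) :
  x != 1%g -> 0 <= q -> q <= 1 -> 0 <= K -> 1 <= n.+2`!%:R * K ->
  q ^+ n.+2 = n.+2`!%:R * K / #|gT|%:R ^+ n.+1 ->
  2 * (n.+2`!%:R * K) * n.+2%:R ^+ 2 <= eta * (#|gT|%:R * q) -> eta <= 1 ->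
  bernE q (fun S => [forall A in img @: good n x, ~~ (A \subset S)]%:R)
    <= expR (- (K * (1 - eta) ^+ 2)).
Proof.
move=> x1 q0 q1 K0 M1 qd Heta eta1.
set d := n.+2 in M1 qd Heta *; set N : R := #|gT|%:R in qd Heta *.
set M := d`!%:R * K in M1 qd Heta.
have N0 : 0 < N by rewrite ltr0n; apply/card_gt0P; exists x.
have q0' : 0 < q.
  rewrite lt_neqAle q0 andbT eq_sym; apply/eqP => qe; move: qd; rewrite qe expr0n /= => /esym/eqP.
  rewrite mulf_eq0 invr_eq0 expf_eq0 (gt_eqF N0) andbF orbF => /eqP; lra.
have y0 : 0 < N * q by rewrite mulr_gt0.
have d0 : 0 < d%:R ^+ 2 :> R by rewrite exprn_gt0 // ltr0n.
have Mge : 2 * d%:R ^+ 2 <= 2 * M * d%:R ^+ 2.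
  by rewrite ler_wpM2r ?(ltW d0) //; lra.
have dy : 2 * d%:R ^+ 2 <= N * q.
  by apply: (le_trans Mge); apply: (le_trans Heta); rewrite ler_piMl // ltW.
have eta0 : 0 <= eta.
  rewrite -(pmulr_lge0 _ y0); apply: le_trans Heta; apply: le_trans Mge; lra.
have yd : (N * q) ^+ d = N * M.
  by rewrite exprMn qd /d [N ^+ n.+2]exprS; field; rewrite expf_neq0 // gt_eqF.
(* As [M >= 1] and [q <= 1], [d^2 <= 2 M d^2 <= eta N q <= eta N]. *)
have dN : d%:R ^+ 2 <= N * eta.
  have : eta * (N * q) <= N * eta.
    by rewrite mulrA [eta * N]mulrC ler_piMr // mulr_ge0 // ltW.
  move: Heta Mge d0; lra.
apply: le_trans (latin_avoid gT d R q eta _ _ q0 q1 (latin_good gT n x) (@good_inj gT n x) _) _ => //.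
  apply: (le_trans (exprD_sub_le _ _ _ y0 dy)).
  rewrite yd -mulrA ler_wpM2l ?(ltW N0) // mulrA ler_pdivrMr //.
  by apply: le_trans Heta; rewrite mulrA [M * 2]mulrC.
rewrite ler_expR lerN2 expr2 mulrA ler_wpM2r ?subr_ge0 //.
have cF := card_img_fibers gT d (good n x) (@good_inj gT n x).
have cG := card_good gT n x x1.
have : (#|gT| ^ n.+1 <= d`! * #|img @: good n x| + d ^ 2 * #|gT| ^ n)%N.
  by apply: (leq_trans cG); rewrite leq_add2r.
rewrite -(ler_nat R) natrD (natrM _ d`!) (natrM _ (d ^ 2)) !natrX -/N => H.
rewrite qd mulrA ler_pdivlMr ?exprn_gt0 // /M.
rewrite (_ : K * (1 - eta) * _ = K * (N ^+ n.+1 - N * eta * N ^+ n)); last by rewrite exprS; ring.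
rewrite [leRHS]mulrA [leRHS]mulrC ler_wpM2l //.
have : d%:R ^+ 2 * N ^+ n <= N * eta * N ^+ n by rewrite ler_wpM2r // exprn_ge0 // ltW.
by move: H; rewrite [#|_|%:R * _]mulrC; lra.
Qed.

(** * Choice of the constants and conclusion *)

Theorem theorem1 (R : realType) (eps gam : R) :
  0 < eps -> 0 < gam -> gam < 1 ->
  forall delta : R, 0 < delta ->
  exists N0 : nat, forall (gT : finGroupType) (d : nat) (p : R),
    (N0 <= #|gT|)%N ->
    (2 <= d)%N -> d%:R <= dN gam #|gT| ->
    p_threshold eps #|gT| d <= p -> p <= 1 ->
    cay_prob p (fun S : {set gT} => ~ diam_le S d) < delta.
Proof.
move=> e0 g0 g1 delta del0.
(* A lower bound for [L = ln N]: the first term gives [ln L >= 1], the second makes [eta] small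
   against [eps], the third gives [N ^ -(eps/2) < delta], and the last gives [L >= 1]. The group,
   [d] and [p] do not enter, whence uniformity. *)
pose K := expR 1 + 8 * (1 + eps) ^+ 2 / eps + `|2 / eps * ln delta| + 1.
exists (Num.bound (expR K)) => gT d p N0; case: d => [|[|n]] // _ dle qp p1.
set q := p_threshold eps #|gT| n.+2 in qp.
set N : R := #|gT|%:R; set L := ln N.
have Npos : 0 < N by rewrite ltr0n; apply/card_gt0P; exists 1%g.
have a0 : 0 < expR 1 :> R := expR_gt0 _.
have b0 : 0 <= 8 * (1 + eps) ^+ 2 / eps by rewrite divr_ge0 ?(ltW e0) // mulr_ge0 ?sqr_ge0.
have c0 : 0 <= `|2 / eps * ln delta| := normr_ge0 _.
have KL : K < L.
  rewrite -ltr_expR lnK ?posrE //; apply: lt_le_trans (archi_boundP (expR_ge0 _)) _.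
  by rewrite ler_nat.
have Le : expR 1 <= L by move: KL; rewrite /K; lra.
have L1 : 1 <= L by move: KL; rewrite /K; lra.
have l1 : 1 <= ln L by rewrite -(expRK 1) ler_ln ?posrE ?expR_gt0 //; lra.
have dL := dN_le _ _ _ _ g0 g1 l1 dle.
have q0 : 0 <= q by rewrite powR_ge0.
have q1 : q <= 1 := le_trans qp p1.
have qd : q ^+ n.+2 = n.+2`!%:R * ((1 + eps) * L) / N ^+ n.+1.
  by rewrite /q p_threshold_expn //= ?mulrA // -/L; lra.
have yd : (N * q) ^+ n.+2 = N * (n.+2`!%:R * (1 + eps) * L).
  by rewrite exprMn qd [N ^+ n.+2]exprS; field; rewrite expf_neq0 // gt_eqF.
have N0' : (0 < #|gT|)%N by rewrite -(ltr0n R).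
have Heta := threshold_dominates _ _ _ _ _ e0 N0' Le dL (mulr_ge0 (ltW Npos) q0) yd.
set eta := 2 * (1 + eps) / ln N in Heta.
have etaL : eta * L = 2 * (1 + eps) by rewrite divfK // gt_eqF // (lt_le_trans ltr01).
have eL : 8 * (1 + eps) ^+ 2 <= eps * L.
  by rewrite [leRHS]mulrC -ler_pdivrMr //; move: KL; rewrite /K; lra.
have eta2 : 4 * (1 + eps) * eta <= eps.
  rewrite -(ler_pM2r (lt_le_trans ltr01 L1)) -[leLHS]mulrA etaL.
  by apply: le_trans eL; rewrite le_eqVlt; apply/orP; left; apply/eqP; ring.
have eta_le1 : eta <= 1.
  rewrite leNgt; apply/negP => h; have : 0 < eps * (eta - 1) by rewrite mulr_gt0 // subr_gt0.
  by move: eta2 h; lra.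
apply: (@le_lt_trans _ _ (expR (L - (1 + eps) * L * (1 - eta) ^+ 2))).
  apply: (le_trans (cay_prob_union _ _ _ _ (le_trans q0 qp) p1)).
  rewrite expRD lnK ?posrE // mulr_natl -sumr_const.
  rewrite [leRHS](bigID (fun x => x != 1%g)) /= -[leLHS]addr0 lerD //; last first.
    by apply: sumr_ge0 => x _; exact: expR_ge0.
  apply: ler_sum => x x1.
  (* Coupling: [p] is lowered to the threshold [q], as avoiding the family is a decreasing
     property. *)
  apply: (@le_trans _ _ (bernE q (fun S =>
      [forall A in img @: good n x, ~~ (A \subset S)]%:R))).
    apply: bernE_anti => // A B AB; apply: ler_bool => /forallP h; apply/forallP => C.
    apply/implyP => CF; have := h C; rewrite CF /=; apply: contra => CA.
    exact: subset_trans CA AB.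
  apply: bernE_good_le => //; first by rewrite mulr_ge0 //; lra.
    have F1 : 1 <= n.+2`!%:R :> R by rewrite ler1n fact_gt0.
    by rewrite !mulr_ege1 //; lra.
  by rewrite [_`!%:R * _]mulrA; exact: Heta.
apply: (@le_lt_trans _ _ (expR (- (eps / 2 * L)))).
  rewrite ler_expR.
  (* Here [(1 - eta)^2 >= 1 - 2 eta] and [2 (1 + eps) eta <= eps / 2]. *)
  have h : 1 + eps / 2 <= (1 + eps) * (1 - eta) ^+ 2.
    have : 0 <= (1 + eps) * eta ^+ 2 by rewrite mulr_ge0 ?sqr_ge0 //; lra.
    move: eta2; rewrite !expr2; nra.
  have := ler_wpM2r (ltW (lt_le_trans ltr01 L1)) h; rewrite mulrAC; lra.
rewrite -[ltRHS]lnK ?posrE // ltr_expR ltrNl.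
have h1 : - (2 / eps * ln delta) < L.
  by apply: le_lt_trans (ler_norm _) _; rewrite normrN; move: KL; rewrite /K; lra.
have e2 : 0 < eps / 2 by lra.
have := h1; rewrite -(ltr_pM2l e2).
by rewrite (_ : eps / 2 * - _ = - ln delta) //; field; rewrite gt_eqF.
Qed.
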